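(* If $E$ is a weak almost Fra\''iss\'e Banach space and $\mathrm{Age}_k(E)$ is compact (with respect to the Banach-Mazur pseudodistance $d_{\mathrm{BM}}$) for all $k\in\mathbb N$, then $E$ is almost Fra\''iss\'e.
   Context: For Banach spaces $X,E$ and $\delta\ge 0$, a $\delta$-isometry from $X$ to $E$ is a linear map $T\colon X\to E$ with $\frac{1}{1+\delta}\|x\|\le\|Tx\|\le(1+\delta)\|x\|$ for all $x\in X$. $\mathrm{Emb}_\delta(X,E)$ is the set of $\delta$-isometries from $X$ into $E$; $\mathrm{Isom}_\varepsilon(E)$ is the set of surjective $\varepsilon$-isometries from $E$ onto $E$. $\mathrm{Age}(E)$ (resp. $\mathrm{Age}_k(E)$) is the set of finite-dimensional (resp. $k$-dimensional) subspaces of $E$. For $k$-dimensional spaces, $d_{\mathrm{BM}}(X,Y)=\inf\{\log(\|T\|\|T^{-1}\|): T\colon X\to Y \text{ is an isomorphism}\}$. $E$ is weak almost Fra\''iss\'e if for every $X\in\mathrm{Age}(E)$ and $\varepsilon>0$ there is $\delta>0$ such that for every $\phi\in\mathrm{Emb}_\delta(X,E)$ there is $T\in\mathrm{Isom}_\varepsilon(E)$ with $T|_X=\phi$. $E$ is almost Fra\''iss\'e if for every $k\in\mathbb N$ and $\varepsilon>0$ there is $\delta>0$ such that for every $X\in\mathrm{Age}_k(E)$ and every $\phi\in\mathrm{Emb}_\delta(X,E)$ there is $T\in\mathrm{Isom}_\varepsilon(E)$ with $T|_X=\phi$. *)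

(* Defs.v *)
From HB Require Import structures.
From mathcomp Require Import all_boot all_order all_algebra.
From mathcomp Require Import complex.
From mathcomp Require Import all_classical all_reals all_analysis.

Set Implicit Arguments.
Unset Strict Implicit.
Unset Printing Implicit Defensive.

Import Order.TTheory GRing.Theory Num.Theory.
Import numFieldNormedType.Exports.

Local Open Scope classical_set_scope.
Local Open Scope ring_scope.

Variant scalar_kind := RealScalars | ComplexScalars.

Definition scalars (R : realType) (s : scalar_kind) : numFieldType :=
  match s with RealScalars => R | ComplexScalars => R[i] end.

Definition real_part (R : realType) (s : scalar_kind) : scalars R s -> R :=
  match s with RealScalars => id | ComplexScalars => @complex.Re R end.

Section RealPart.
Variables (R : realType) (s : scalar_kind).
Local Notation K := (scalars R s).
Local Notation re := (@real_part R s).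

Lemma real_part0 : re 0 = 0. Proof. by case: s. Qed.

Lemma real_partM (x y : K) : 0 <= x -> 0 <= y -> re (x * y) = re x * re y.
Proof.
case: s x y => //= -[a b] [c d]; rewrite !lecE/= => /andP[/eqP-> _].
by move=> /andP[/eqP-> _]; rewrite mulr0 subr0.
Qed.

Lemma le_real_part (x y : K) : x <= y -> re x <= re y.
Proof. by case: s x y => //= -[a b] [c d]; rewrite lecE/= => /andP[]. Qed.

Lemma real_part_gt0 (x : K) : 0 < x -> 0 < re x.
Proof. by case: s x => //= -[a b]; rewrite ltcE/= => /andP[]. Qed.

Lemma real_part_surj (r : R) : 0 <= r -> exists2 k : K, 0 <= k & re k = r.
Proof.
move=> r0; case: s => /=; first by exists r.
by exists (Complex r 0) => //; rewrite lecE/= eqxx r0.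
Qed.

End RealPart.

(* The norm of the library takes its values in the scalar field; this is the
   same norm with values in R, also for complex spaces. *)
Definition rnorm (R : realType) (s : scalar_kind)
  (V : normedModType (scalars R s)) (x : V) : R := real_part `|x|.

Section RNorm.
Variables (R : realType) (s : scalar_kind).
Local Notation K := (scalars R s).
Implicit Type V : normedModType K.

Lemma rnorm_ge0 V (x : V) : 0 <= rnorm x.
Proof. by rewrite -(real_part0 R s) le_real_part. Qed.

Lemma rnorm0 V : rnorm (0 : V) = 0.
Proof. by rewrite /rnorm normr0 real_part0. Qed.

Lemma rnorm_gt0 V (x : V) : x != 0 -> 0 < rnorm x.
Proof. by move=> x0; rewrite real_part_gt0// normr_gt0. Qed.

Lemma rnormZ V (a : K) (x : V) : rnorm (a *: x) = real_part `|a| * rnorm x.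
Proof. by rewrite /rnorm normrZ real_partM. Qed.

End RNorm.

(* Linear subspaces of E.  The library's [submodClosed E], like [pred E], lives in
   too large a universe to carry a topology. *)
Record subspaces (K : numFieldType) (E : normedModType K) := Subspaces {
  subspace_pred : E -> bool;
  subspace_closed : submod_closed subspace_pred }.

HB.instance Definition _ (K : numFieldType) (E : normedModType K)
    (X : subspaces E) :=
  GRing.isSubmodClosed.Build K E (subspace_pred X) (subspace_closed X).

Section Submod.
Variables (K : numFieldType) (E : normedModType K) (X : subspaces E).

Record submod := Submod { submod_val : E; _ : submod_val \in subspace_pred X }.

HB.instance Definition _ := [isSub for submod_val].
HB.instance Definition _ := [Choice of submod by <:].
HB.instance Definition _ := [SubChoice_isSubLmodule of submod by <:].

Let submod_norm (x : submod) : K := `|val x|.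

Let submod_ler_normD x y :
  submod_norm (x + y) <= submod_norm x + submod_norm y.
Proof. by rewrite /submod_norm raddfD ler_normD. Qed.

Let submod_normrZ (l : K) x : submod_norm (l *: x) = `|l| * submod_norm x.
Proof. by rewrite /submod_norm linearZ/= normrZ. Qed.

Let submod_normr0_eq0 x : submod_norm x = 0 -> x = 0.
Proof. by move=> /normr0_eq0 x0; apply: val_inj; rewrite raddf0. Qed.

HB.instance Definition _ := Lmodule_isNormed.Build K submod
  submod_ler_normD submod_normrZ submod_normr0_eq0.

Lemma submod_normE (x : submod) : `|x| = `|val x|. Proof. by []. Qed.

End Submod.

Section OperatorNorm.
Variables (R : realType) (s : scalar_kind).
Local Notation K := (scalars R s).
Implicit Types V W U : normedModType K.

Definition opnorm V W (T : V -> W) : R :=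
  sup [set rnorm (T x) | x in [set x : V | rnorm x <= 1]].

Lemma opnorm_lb V W (T : {linear V -> W}) (c : R) :
  0 <= c -> (forall x, rnorm (T x) <= c * rnorm x) -> opnorm T <= c.
Proof.
move=> c0 Tc; apply: ge_sup.
  by exists (rnorm (T 0)), 0 => //=; rewrite rnorm0.
by move=> _ [x /= x1 <-]; apply: le_trans (Tc x) _; rewrite ler_piMr.
Qed.

Lemma linear_continuous_rbounded V W (T : {linear V -> W}) : continuous T ->
  exists2 c : R, 0 <= c & forall x, rnorm (T x) <= c * rnorm x.
Proof.
move=> /linear_bounded_continuous/linear_boundedP/pinfty_ex_gt0[M M0 TM].
exists (real_part M); first exact/ltW/real_part_gt0.
move=> x; rewrite /rnorm -real_partM ?(ltW M0)//.
exact: le_real_part (TM x).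
Qed.

Lemma opnorm_ge0 V W (T : {linear V -> W}) : continuous T -> 0 <= opnorm T.
Proof.
move=> /linear_continuous_rbounded[c c0 Tc]; apply: le_trans (ub_le_sup _ _).
- exact: (rnorm_ge0 (T 0)).
- exists c => _ [x /= x1 <-]; apply: le_trans (Tc x) _.
  by rewrite ler_piMr.
- by exists 0 => //=; rewrite rnorm0.
Qed.

Lemma opnormP V W (T : {linear V -> W}) : continuous T ->
  forall x, rnorm (T x) <= opnorm T * rnorm x.
Proof.
move=> /linear_continuous_rbounded[c c0 Tc] x.
have [->|x0] := eqVneq x 0; first by rewrite linear0 !rnorm0 mulr0.
have nx0 := rnorm_gt0 x0.
have [a a0 ra] : exists2 a : K, 0 <= a & real_part a = (rnorm x)^-1.
  by apply: real_part_surj; rewrite invr_ge0 ltW.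
have e V' (y : V') : rnorm (a *: y) = (rnorm x)^-1 * rnorm y.
  by rewrite rnormZ ger0_norm// ra.
rewrite -ler_pdivrMr// mulrC -e -linearZ; apply: ub_le_sup.
  exists c => _ [y /= y1 <-]; apply: le_trans (Tc y) _.
  by rewrite ler_piMr.
by exists (a *: x) => //=; rewrite e mulVf// gt_eqF.
Qed.

Lemma opnorm_comp V W U (T : {linear V -> W}) (S : {linear W -> U}) :
  continuous T -> continuous S -> opnorm (S \o T) <= opnorm S * opnorm T.
Proof.
move=> cT cS; apply: opnorm_lb; first by rewrite mulr_ge0// opnorm_ge0.
move=> x /=; apply: le_trans (opnormP cS _) _.
by rewrite -mulrA ler_wpM2l ?opnorm_ge0// opnormP.
Qed.

End OperatorNorm.

Section BanachMazur.
Variables (R : realType) (s : scalar_kind).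
Local Notation K := (scalars R s).
Implicit Types V W U : normedModType K.

(* T is an isomorphism with inverse S; continuity is automatic in finite
   dimension. *)
Definition inverse_isomorphisms V W
    (T : {linear V -> W}) (S : {linear W -> V}) :=
  [/\ cancel T S, cancel S T, continuous T & continuous S].

(* The infimum is taken in the extended reals: spaces which are not isomorphic
   are at distance +oo.  For the trivial space, ln 0 = 0. *)
Definition banach_mazur V W : \bar R :=
  ereal_inf [set d | exists (T : {linear V -> W}) (S : {linear W -> V}),
    inverse_isomorphisms T S /\ d = (ln (opnorm T * opnorm S))%:E].

Lemma inverse_isomorphisms_opnorm V W
    (T : {linear V -> W}) (S : {linear W -> V}) :
  inverse_isomorphisms T S ->
  opnorm T = 0 /\ opnorm S = 0 \/
  [/\ 0 < opnorm T, 0 < opnorm S & 1 <= opnorm T * opnorm S].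
Proof.
move=> [TK SK cT cS].
have T0 := opnorm_ge0 cT; have S0 := opnorm_ge0 cS.
have [[x x0]|V0] := pselect (exists x : V, x != 0).
  right; have nx := rnorm_gt0 x0.
  have TS1 : 1 <= opnorm T * opnorm S.
    rewrite -(ler_pM2r nx) mul1r -[in leLHS](TK x).
    apply: le_trans (opnormP cS _) _.
    by rewrite (mulrC (opnorm T)) -mulrA ler_wpM2l// opnormP.
  have TS0 := lt_le_trans ltr01 TS1.
  split=> //; rewrite lt_neqAle ?T0 ?S0 andbT; apply/eqP => e.
    by rewrite -e mul0r ltxx in TS0.
  by rewrite -e mulr0 ltxx in TS0.
have {}V0 (x : V) : x = 0.
  by apply/eqP/negPn/negP => x0; apply: V0; exists x.
left; split; apply/eqP; rewrite eq_le ?T0 ?S0 andbT; apply: opnorm_lb => // x.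
  by rewrite (V0 x) linear0 !rnorm0 mulr0.
by rewrite (V0 (S x)) rnorm0 mul0r.
Qed.

Lemma banach_mazur_ltP V W (e : R) : (banach_mazur V W < e%:E)%E <->
  exists (T : {linear V -> W}) (S : {linear W -> V}),
    inverse_isomorphisms T S /\ ln (opnorm T * opnorm S) < e.
Proof.
split=> [/ereal_inf_lt[_ [T [S [TS ->]]]]|[T [S [TS lt]]]].
  by rewrite lte_fin => lt; exists T, S.
rewrite -lte_fin in lt; apply: le_lt_trans lt; apply: ereal_inf_lbound.
by exists T, S.
Qed.

Lemma banach_mazur_refl V (e : R) : 0 < e -> (banach_mazur V V < e%:E)%E.
Proof.
move=> e0; apply/banach_mazur_ltP; exists idfun, idfun.
split; first by split=> // x; apply: cvg_id.
apply: le_lt_trans e0; apply: ln_le0.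
have id1 : opnorm (@idfun V) <= 1 by apply: opnorm_lb => // x; rewrite mul1r.
have id0 : 0 <= opnorm (@idfun V) by apply: opnorm_ge0 => x; apply: cvg_id.
by rewrite mulr_ile1.
Qed.

Lemma banach_mazur_sym V W (e : R) :
  (banach_mazur V W < e%:E -> banach_mazur W V < e%:E)%E.
Proof.
move=> /banach_mazur_ltP[T [S [[TK SK cT cS] lt]]].
by apply/banach_mazur_ltP; exists S, T; rewrite mulrC.
Qed.

Lemma banach_mazur_triangle V W U (e1 e2 : R) :
  (banach_mazur V W < e1%:E -> banach_mazur W U < e2%:E ->
   banach_mazur V U < (e1 + e2)%:E)%E.
Proof.
move=> /banach_mazur_ltP[T [S [TS lt1]]] /banach_mazur_ltP[T' [S' [TS' lt2]]].
have [TK SK cT cS] := TS; have [TK' SK' cT' cS'] := TS'.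
have TTS : inverse_isomorphisms (T' \o T) (S \o S').
  split; [exact: can_comp|exact: can_comp| |].
  - by move=> x; apply: continuous_comp; [exact: cT|exact: cT'].
  - by move=> x; apply: continuous_comp; [exact: cS'|exact: cS].
apply/banach_mazur_ltP; exists (T' \o T), (S \o S'); split=> //.
apply: le_lt_trans (ltrD lt1 lt2).
have := opnorm_comp cT cT'; have := opnorm_comp cS' cS.
have [[-> ->]|[p1 p2 p12]] := inverse_isomorphisms_opnorm TS;
  have [[-> ->]|[p1' p2' p12']] := inverse_isomorphisms_opnorm TS'.
- have [[-> ->] _ _|[q1 q2 _]] := inverse_isomorphisms_opnorm TTS.
    by rewrite mulr0 ln0// addr0.
  by rewrite mulr0 leNgt q2.
- have [[-> ->] _ _|[q1 q2 _]] := inverse_isomorphisms_opnorm TTS.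
    by rewrite mulr0 ln0// add0r ln_ge0.
  by rewrite mul0r leNgt q2.
- have [[-> ->] _ _|[q1 q2 _]] := inverse_isomorphisms_opnorm TTS.
    by rewrite mulr0 ln0// addr0 ln_ge0.
  by rewrite mulr0 leNgt q2.
move=> le1 le2; rewrite -lnM ?posrE ?mulr_gt0//.
have [[-> ->]|[q1 q2 q12]] := inverse_isomorphisms_opnorm TTS.
  by rewrite mulr0 ln0// ln_ge0// mulr_ege1.
rewrite ler_ln ?posrE ?mulr_gt0//.
apply: le_trans (ler_pM (ltW q1) (ltW q2) le2 le1) _.
by rewrite (mulrC (opnorm T')) mulrACA.
Qed.

End BanachMazur.

Section Subspaces.
Variables (R : realType) (s : scalar_kind) (E : normedModType (scalars R s)).
Local Notation T := (subspaces E).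

HB.instance Definition _ := gen_eqMixin T.
HB.instance Definition _ := gen_choiceMixin T.

Definition bm_ball (X : T) (r : R) : set T :=
  [set Y : T | (banach_mazur (submod X) (submod Y) < r%:E)%E].

Let bm_ent : set_system (T * T) := entourage_ bm_ball.

HB.instance Definition _ := hasNbhs.Build T (nbhs_ bm_ent).

Let bm_ball_center (X : T) (e : R) : 0 < e -> bm_ball X e X.
Proof. exact: banach_mazur_refl. Qed.

Let bm_ball_sym (X Y : T) (e : R) : bm_ball X e Y -> bm_ball Y e X.
Proof. exact: banach_mazur_sym. Qed.

Let bm_ball_triangle (X Y Z : T) (e1 e2 : R) :
  bm_ball X e1 Y -> bm_ball Y e2 Z -> bm_ball X (e1 + e2) Z.
Proof. exact: banach_mazur_triangle. Qed.

HB.instance Definition _ := @Nbhs_isPseudoMetric.Build R T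
  bm_ent erefl bm_ball bm_ball_center bm_ball_sym bm_ball_triangle erefl.

Definition has_dim (k : nat) (X : T) := exists b : 'I_k -> submod X,
  forall x, exists! c : {ffun 'I_k -> scalars R s}, x = \sum_i c i *: b i.

Definition Age_ (k : nat) : set T := [set X | has_dim k X].

Definition Age : set T := \bigcup_k Age_ k.

End Subspaces.
Arguments Age_ {R s} E k.
Arguments Age {R s} E.

Section AlmostFraisse.
Variables (R : realType) (s : scalar_kind).
Local Notation K := (scalars R s).

Definition Emb (delta : R) (V W : normedModType K) : set {linear V -> W} :=
  [set T | forall x,
    (1 + delta)^-1 * rnorm x <= rnorm (T x) <= (1 + delta) * rnorm x].

Definition Isom (eps : R) (V : normedModType K) : set {linear V -> V} :=
  [set T | Emb eps T /\ set_surj setT setT T].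

Definition extends (E : normedModType K) (X : subspaces E)
    (phi : {linear submod X -> E}) (T : {linear E -> E}) :=
  forall x : submod X, T (val x) = phi x.

Definition weak_almost_Fraisse (E : completeNormedModType K) :=
  forall X : subspaces E, Age E X -> forall eps : R, 0 < eps ->
  exists2 delta : R, 0 < delta &
  forall phi : {linear submod X -> E}, Emb delta phi ->
  exists2 T : {linear E -> E}, Isom eps T & extends phi T.

Definition almost_Fraisse (E : completeNormedModType K) :=
  forall (k : nat) (eps : R), 0 < eps ->
  exists2 delta : R, 0 < delta &
  forall X : subspaces E, Age_ E k X ->
  forall phi : {linear submod X -> E}, Emb delta phi ->
  exists2 T : {linear E -> E}, Isom eps T & extends phi T.

End AlmostFraisse.

(* Main.v *)
From HB Require Import structures.
Require Import Defs.
From mathcomp Require Import all_boot all_order all_algebra.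
From mathcomp Require Import all_classical all_reals all_analysis.

(** Let [X] be [k]-dimensional.  If [Y] is close to [X] in the Banach-Mazur
    distance, a near-isometry [theta : X -> Y] extends to a near-isometric
    automorphism [T] of [E], and for a near-isometry [phi : Y -> E] the map
    [phi \o theta] also extends to such an automorphism [S].  Then [S \o T^-1]
    extends [phi].  Hence the [delta] given by the weak property at [X] yields
    one that works on a neighbourhood of [X], and compactness makes it
    uniform. *)

Import Order.TTheory GRing.Theory Num.Theory.

Local Open Scope classical_set_scope.
Local Open Scope ring_scope.

(** Composition multiplies the factors [1 + d], so with this [d] a composite of two [d]-isometries
    is an [e]-isometry. *)
Lemma square_expansion_le (R : rcfType) (e : R) : 0 < e ->
  exists2 d : R, 0 < d & (1 + d) * (1 + d) <= 1 + e.
Proof.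
move=> e0; exists (Num.sqrt (1 + e) - 1).
  by rewrite subr_gt0 -{1}sqrtr1 ltr_sqrt ?ltrDl// addr_gt0.
by rewrite addrC subrK -expr2 sqr_sqrtr// addr_ge0// ltW.
Qed.

Lemma linear_bijection_inverse (K : numFieldType) (V W : lmodType K)
    (T : {linear V -> W}) : injective T -> set_surj setT setT T ->
  exists S : {linear W -> V}, cancel T S /\ cancel S T.
Proof.
move=> Tinj Tsurj.
have /choice[g gK] (y : W) : exists x, T x = y.
  by have [x _ <-] := Tsurj y Logic.I; exists x.
have Kg : cancel T g by move=> x; apply: Tinj; rewrite gK.
pose gL := GRing.isLinear.Build K W V _ g (can2_linear Kg gK).
by exists (HB.pack_for {linear W -> V} g gL).
Qed.

Section Embeddings.
Variables (R : realType) (s : scalar_kind).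
Local Notation K := (scalars R s).
Implicit Types V W U : normedModType K.

Lemma Emb_inj V W (d : R) (T : {linear V -> W}) : 0 < d -> Emb d T ->
  injective T.
Proof.
move=> d0 dT x y Txy; apply/eqP; rewrite -subr_eq0; apply/negPn/negP => xy.
have /andP[+ _] := dT (x - y).
rewrite linearB Txy subrr rnorm0 leNgt mulr_gt0// ?rnorm_gt0//.
by rewrite invr_gt0 addr_gt0.
Qed.

Lemma Emb_comp V W U (d e f : R) (T : {linear V -> W}) (S : {linear W -> U}) :
  0 < d -> 0 < e -> (1 + d) * (1 + e) <= 1 + f ->
  Emb d T -> Emb e S -> Emb f (S \o T).
Proof.
move=> d0 e0 def dT eS x /=.
have [/andP[T1 T2] /andP[S1 S2]] := (dT x, eS (T x)).
have [d1 e1] : 0 < 1 + d /\ 0 < 1 + e by rewrite !addr_gt0.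
have f1 : 0 < 1 + f by apply: lt_le_trans def; rewrite mulr_gt0.
apply/andP; split.
  apply: le_trans S1; rewrite ler_pdivlMl//; apply: le_trans T1.
  rewrite ler_pdivlMl// !mulrA ler_piMl ?rnorm_ge0//.
  by rewrite ler_pdivrMr// mul1r.
apply: le_trans S2 _; apply: le_trans (ler_wpM2l (ltW e1) T2) _.
by rewrite mulrA ler_wpM2r ?rnorm_ge0// mulrC.
Qed.

(** The lower and upper factors are reciprocal, so passing to the inverse swaps the two bounds. *)
Lemma Emb_inverse V W (d : R) (T : {linear V -> W}) (S : {linear W -> V}) :
  0 < d -> cancel S T -> Emb d T -> Emb d S.
Proof.
move=> d0 TK dT y; have d1 : 0 < 1 + d by rewrite addr_gt0.
have := dT (S y); rewrite TK => /andP[T1 T2].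
by rewrite ler_pdivrMl// T2 -ler_pdivrMl.
Qed.

(* Scaling [T] by [sqrt (|S| / |T|)] gives both [T] and its inverse the norm
   [sqrt (|T| |S|)]. *)
Lemma banach_mazur_lt_Emb V W (d : R) : 0 < d ->
  (banach_mazur V W < (ln ((1 + d) ^+ 2))%:E)%E ->
  exists (T : {linear V -> W}) (S : {linear W -> V}),
    [/\ cancel T S, cancel S T & Emb d T].
Proof.
move=> d0 /banach_mazur_ltP[T [S [TS lnTS]]].
have [TK SK cT cS] := TS.
have d1 : 0 < 1 + d by rewrite addr_gt0.
have [[T0 S0]|[T0 S0 TS1]] := inverse_isomorphisms_opnorm TS.
  (* Both norms vanish only for trivial spaces; there [T] itself serves and no ratio is formed. *)
  exists T, S; split=> // x.
  have rT0 z : rnorm (T z) = 0.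
    apply/le_anti; rewrite rnorm_ge0 andbT.
    by have := opnormP cT z; rewrite T0 mul0r.
  have rx0 : rnorm x = 0.
    apply/le_anti; rewrite rnorm_ge0 andbT.
    by have := opnormP cS (T x); rewrite S0 mul0r TK.
  by rewrite rT0 rx0 !mulr0 lexx.
set a := opnorm T in T0 TS1 lnTS; set b := opnorm S in S0 TS1 lnTS.
have ab : a * b <= (1 + d) ^+ 2.
  by rewrite ltW// -ltr_ln ?posrE ?exprn_gt0 ?mulr_gt0.
(* The norms are real but scaling takes place in [K], so the factor is lifted to a scalar
   [k >= 0]. *)
have [k k0 rk] := real_part_surj s (sqrtr_ge0 (b / a)).
set r := Num.sqrt (b / a) in rk.
have r0 : 0 < r by rewrite sqrtr_gt0 divr_gt0.
have rr : r ^+ 2 = b / a by rewrite sqr_sqrtr// ltW// divr_gt0.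
have kneq0 : k != 0.
  by apply/eqP => k00; move: r0; rewrite -rk k00 real_part0 ltxx.
(* Both [r * a] and [b / r] have square [a * b], so it suffices to compare squares. *)
have ra : r * a <= 1 + d.
  rewrite -(ler_pXn2r (ltn0Sn 1)) ?nnegrE ?mulr_ge0 ?(ltW r0) ?(ltW T0) ?(ltW d1)//.
  by rewrite exprMn rr expr2 mulrA divfK ?gt_eqF// mulrC.
have br : b / r <= 1 + d.
  rewrite -(ler_pXn2r (ltn0Sn 1)) ?nnegrE ?divr_ge0 ?(ltW r0) ?(ltW S0) ?(ltW d1)//.
  by rewrite expr_div_n rr invf_div mulrA expr2 mulrAC mulfK ?gt_eqF// mulrC.
exists (k \*: T), (k^-1 \*: S); split=> [x|y|x] /=.
- by rewrite linearZ scalerA mulVf// scale1r TK.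
- by rewrite linearZ scalerA mulfV// scale1r SK.
have -> : rnorm (k *: T x) = r * rnorm (T x) by rewrite rnormZ ger0_norm// rk.
apply/andP; split.
  have := opnormP cS (T x); rewrite TK -/b => xb.
  rewrite ler_pdivrMl//; apply: le_trans xb _; rewrite mulrA.
  by rewrite ler_wpM2r ?rnorm_ge0// -ler_pdivrMr.
apply: le_trans (ler_wpM2l (ltW r0) (opnormP cT x)) _.
by rewrite mulrA ler_wpM2r ?rnorm_ge0.
Qed.

(** Letting [Y] and [delta] vary jointly gives the local form that near-covering compactness turns
    into a uniform one. *)
Lemma weak_almost_Fraisse_near (E : completeNormedModType K)
    (X : subspaces E) (eps : R) :
  weak_almost_Fraisse E -> Age E X -> 0 < eps ->
  \forall Y \near X & delta \near 0^'+,
    forall phi : {linear submod Y -> E}, Emb delta phi ->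
    exists2 T : {linear E -> E}, Isom eps T & extends phi T.
Proof.
move=> wE XE /square_expansion_le[e e0 e_eps].
have [d d0 dX] := wE X XE e e0.
(* With [th] a [d']-isometry and [phi] a [t]-isometry, [t <= d'], the composite [phi \o th] is a
   [d]-isometry. *)
have [d' d'0 d'd] := square_expansion_le _ _ d0.
have ln0 : 0 < ln ((1 + d') ^+ 2) by rewrite ln_gt0// exprn_egt1// ltrDl.
exists (ball X (ln ((1 + d') ^+ 2)), [set t | 0 < t /\ t <= d']).
  split; first exact: nbhsx_ballx.
  by near=> t; split; near: t; [exact: nbhs_right_gt|exact: nbhs_right_le].
move=> [Y t] /= [/(banach_mazur_lt_Emb _ _ _ d'0)[th [th' [thK th'K dth]]] [t0 td]].
move=> phi dphi.
have dd : d' <= d.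
  rewrite -(lerD2l 1); apply: le_trans d'd.
  by rewrite ler_peMr ?lerDl ?addr_ge0// ltW.
have [T [eT surjT] Tth] : exists2 T : {linear E -> E}, Isom e T &
    extends (val \o th : {linear submod X -> E}) T.
  apply: dX => x; have /andP[l u] := dth x.
  have d'1 : 0 < 1 + d' by rewrite addr_gt0.
  apply/andP; split; [apply: le_trans l|apply: le_trans u _];
    rewrite ler_wpM2r ?rnorm_ge0 ?lerD2l//.
  by rewrite lef_pV2 ?posrE ?addr_gt0// lerD2l.
have [S [eS surjS] Sphi] : exists2 S : {linear E -> E}, Isom e S &
    extends (phi \o th) S.
  apply: dX; apply: Emb_comp dth dphi => //.
  by apply: le_trans d'd; rewrite ler_wpM2l ?lerD2l ?addr_ge0 ?(ltW d'0).
have [T' [TK T'K]] := linear_bijection_inverse _ _ _ T (Emb_inj _ _ _ _ e0 eT) surjT.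
exists (S \o T'); first split.
- apply: (Emb_comp _ _ _ _ _ _ _ _ e0 e0 e_eps _ eS).
  exact: (Emb_inverse _ _ _ _ _ e0 T'K eT).
- move=> y _; have [x _ <-] := surjS y Logic.I.
  by exists (T x) => //=; rewrite TK.
(* Since [T] acts as [th] on [X], its inverse acts as [th'] on [Y]. *)
move=> y /=; have -> : T' (val y) = val (th' y).
  by rewrite -[y in LHS]th'K -[LHS]/(T' ((val \o th) (th' y))) -Tth TK.
by rewrite Sphi /= th'K.
Unshelve. all: by end_near. Qed.

End Embeddings.

Theorem corollary4p5 (R : realType) (s : scalar_kind)
    (E : completeNormedModType (scalars R s)) :
  weak_almost_Fraisse E ->
  (forall k : nat, compact (Age_ E k)) ->
  almost_Fraisse E.
Proof.
move=> wE cE k eps eps0.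
(* Near-covering moves the quantifier over [X] inside: every small enough [delta > 0] serves all of
   [Age_ E k] at once. *)
have /compact_near_coveringP/(_ R (0 : R)^'+ _ _) cov := cE k.
have nearP := cov _ (fun X XE =>
  weak_almost_Fraisse_near _ _ E X eps wE (ex_intro2 _ _ k Logic.I XE) eps0).
have [d [d0 dP]] := filter_ex (filterI (nbhs_right_gt (0 : R)) nearP).
by exists d.
Qed.
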